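(* Consider the theory in the language $\{\times,\mathbf 1,{}^{-1}\}$ with the following axioms, where $n$ ranges over all natural numbers $n\ge 1$, and, in (M$_{16,n}$), $\ell\geq 1$ and $m_1,\dots,m_\ell$ range over all positive natural numbers such that none of the $m_k$'s divides $n$ (i.e. $m_1\nmid n,\dots,m_\ell\nmid n$): (M$_1$) $\forall x,y,z\,(x\cdot(y\cdot z)=(x\cdot y)\cdot z)$; (M$_2$) $\forall x\,(x\cdot\mathbf 1=x)$; (M$_3^\circ$) $\forall x\,(x\cdot x^{-1}=\mathbf 1)$; (M$_4$) $\forall x,y\,(x\cdot y=y\cdot x)$; (M$_{7,n}^\circ$) $\forall x\,(x^n=\mathbf 1\rightarrow x=\mathbf 1)$; (M$_{16,n}$) $\forall v_1,\dots,v_\ell\,\exists x\,\forall z\,\bigwedge_{k=1}^{\ell}\bigl(x^n\cdot v_k\neq z^{m_k}\bigr)$. This theory completely axiomatizes the structure $\langle\mathbb Q^+;\times,\mathbf 1,{}^{-1}\rangle$.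
   Context: $\mathbb Q^+$ is the set of positive rational numbers, $\times$ (also written $\cdot$) is multiplication and ${}^{-1}$ is the multiplicative inverse. $x^n$ abbreviates $x\cdot x\cdots x$ ($n$ times). A theory completely axiomatizes a structure if, for every first-order sentence of the language of the structure, the sentence is true in the structure if and only if it is provable from the theory. *)

(* Defs.v *)
From HB Require Import structures.
From mathcomp Require Import all_boot all_order all_algebra.

Set Implicit Arguments.
Unset Strict Implicit.
Unset Printing Implicit Defensive.

Import Order.TTheory GRing.Theory Num.Theory.

(* First-order logic with equality over the language {*, 1, ^-1}.
   Variables are de Bruijn indices: [Var 0] refers to the innermost
   enclosing quantifier. *)

Inductive term : Type :=
  | Var of nat
  | One
  | Mul of term & term
  | Inv of term.

Inductive form : Type :=
  | Bot
  | Eq of term & term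
  | Imp of form & form
  | And of form & form
  | Or of form & form
  | All of form
  | Ex of form.

Definition Neg (phi : form) : form := Imp phi Bot.

Lemma term_comparable : comparable term.
Proof. by move=> s t; rewrite /decidable; decide equality; decide equality. Qed.

HB.instance Definition _ := hasDecEq.Build term (compareP term_comparable).

Lemma form_comparable : comparable form.
Proof.
by move=> s t; rewrite /decidable; decide equality; apply: term_comparable.
Qed.

HB.instance Definition _ := hasDecEq.Build form (compareP form_comparable).

Fixpoint term_subst (sigma : nat -> term) (t : term) : term :=
  match t with
  | Var i => sigma i
  | One => One
  | Mul s u => Mul (term_subst sigma s) (term_subst sigma u)
  | Inv s => Inv (term_subst sigma s)
  end.

Definition scons (t : term) (sigma : nat -> term) (i : nat) : term :=
  if i is j.+1 then sigma j else t.

Definition shift_var (i : nat) : term := Var i.+1.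

Definition up (sigma : nat -> term) : nat -> term :=
  scons (Var 0) (fun i => term_subst shift_var (sigma i)).

Fixpoint subst (sigma : nat -> term) (phi : form) : form :=
  match phi with
  | Bot => Bot
  | Eq s t => Eq (term_subst sigma s) (term_subst sigma t)
  | Imp a b => Imp (subst sigma a) (subst sigma b)
  | And a b => And (subst sigma a) (subst sigma b)
  | Or a b => Or (subst sigma a) (subst sigma b)
  | All a => All (subst (up sigma) a)
  | Ex a => Ex (subst (up sigma) a)
  end.

Definition shift : form -> form := subst shift_var.

(* The instance phi[t] of the body phi of a quantified formula. *)
Definition inst (t : term) (phi : form) : form := subst (scons t Var) phi.

Fixpoint term_closed (n : nat) (t : term) : bool :=
  match t with
  | Var i => i < n
  | One => true
  | Mul s u => term_closed n s && term_closed n u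
  | Inv s => term_closed n s
  end.

(* All free variables of phi have index below n. *)
Fixpoint closed (n : nat) (phi : form) : bool :=
  match phi with
  | Bot => true
  | Eq s t => term_closed n s && term_closed n t
  | Imp a b | And a b | Or a b => closed n a && closed n b
  | All a | Ex a => closed n.+1 a
  end.

Definition sentence (phi : form) : bool := closed 0 phi.

(* Classical natural deduction with equality. Shifting the context in
   [nd_AllI] and [nd_ExE] makes [Var 0] the eigenvariable. *)
Inductive nd : seq form -> form -> Prop :=
  | nd_Hyp G phi : phi \in G -> nd G phi
  | nd_Raa G phi : nd (Neg phi :: G) Bot -> nd G phi
  | nd_ImpI G phi psi : nd (phi :: G) psi -> nd G (Imp phi psi)
  | nd_ImpE G phi psi : nd G (Imp phi psi) -> nd G phi -> nd G psi
  | nd_AndI G phi psi : nd G phi -> nd G psi -> nd G (And phi psi)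
  | nd_AndEl G phi psi : nd G (And phi psi) -> nd G phi
  | nd_AndEr G phi psi : nd G (And phi psi) -> nd G psi
  | nd_OrIl G phi psi : nd G phi -> nd G (Or phi psi)
  | nd_OrIr G phi psi : nd G psi -> nd G (Or phi psi)
  | nd_OrE G phi psi chi :
      nd G (Or phi psi) -> nd (phi :: G) chi -> nd (psi :: G) chi -> nd G chi
  | nd_AllI G phi : nd (map shift G) phi -> nd G (All phi)
  | nd_AllE G phi t : nd G (All phi) -> nd G (inst t phi)
  | nd_ExI G phi t : nd G (inst t phi) -> nd G (Ex phi)
  | nd_ExE G phi psi :
      nd G (Ex phi) -> nd (phi :: map shift G) (shift psi) -> nd G psi
  | nd_EqI G t : nd G (Eq t t)
  | nd_EqE G phi s t : nd G (Eq s t) -> nd G (inst s phi) -> nd G (inst t phi).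

Definition theory : Type := form -> Prop.

Definition provable (T : theory) (phi : form) : Prop :=
  exists2 G : seq form, (forall psi, psi \in G -> T psi) & nd G phi.

Record structure : Type := Structure {
  carrier :> Type;
  s_mul : carrier -> carrier -> carrier;
  s_one : carrier;
  s_inv : carrier -> carrier
}.

Fixpoint eval (M : structure) (rho : nat -> M) (t : term) : M :=
  match t with
  | Var i => rho i
  | One => s_one M
  | Mul s u => s_mul (eval rho s) (eval rho u)
  | Inv s => s_inv (eval rho s)
  end.

Definition env_cons (M : structure) (a : M) (rho : nat -> M) (i : nat) : M :=
  if i is j.+1 then rho j else a.

Fixpoint sat (M : structure) (rho : nat -> M) (phi : form) : Prop :=
  match phi with
  | Bot => False
  | Eq s t => eval rho s = eval rho t
  | Imp a b => sat rho a -> sat rho b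
  | And a b => sat rho a /\ sat rho b
  | Or a b => sat rho a \/ sat rho b
  | All a => forall d : M, sat (env_cons d rho) a
  | Ex a => exists d : M, sat (env_cons d rho) a
  end.

Definition true_in (M : structure) (phi : form) : Prop :=
  forall rho : nat -> M, sat rho phi.

Definition completely_axiomatizes (T : theory) (M : structure) : Prop :=
  forall phi : form, sentence phi -> (true_in M phi <-> provable T phi).

Definition Qpos : Type := {q : rat | (0 < q)%R}.

Definition Qpos_mul (x y : Qpos) : Qpos :=
  exist _ (val x * val y)%R (mulr_gt0 (valP x) (valP y)).

Definition Qpos_one : Qpos := exist _ 1%R ltr01.

Lemma Qpos_inv_subproof (x : Qpos) : (0 < (val x)^-1)%R.
Proof. by rewrite invr_gt0; exact: valP x. Qed.

Definition Qpos_inv (x : Qpos) : Qpos :=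
  exist _ (val x)^-1%R (Qpos_inv_subproof x).

Definition Qpos_structure : structure :=
  Structure Qpos_mul Qpos_one Qpos_inv.

(* t * (t * ... * t) with n factors, for n >= 1 *)
Definition pow (t : term) (n : nat) : term := iterop n Mul t One.

(* Used only for nonempty s. *)
Fixpoint big_and (s : seq form) : form :=
  match s with
  | [::] => Neg Bot
  | [:: phi] => phi
  | phi :: s' => And phi (big_and s')
  end.

Definition M1 : form :=
  All (All (All (Eq (Mul (Var 2) (Mul (Var 1) (Var 0)))
                    (Mul (Mul (Var 2) (Var 1)) (Var 0))))).

Definition M2 : form := All (Eq (Mul (Var 0) One) (Var 0)).

Definition M3 : form := All (Eq (Mul (Var 0) (Inv (Var 0))) One).

Definition M4 : form :=
  All (All (Eq (Mul (Var 1) (Var 0)) (Mul (Var 0) (Var 1)))).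

Definition M7 (n : nat) : form :=
  All (Imp (Eq (pow (Var 0) n) One) (Eq (Var 0) One)).

(* With l = size ms, v_1, ..., v_l are bound in this order, so under all
   the quantifiers z is [Var 0], x is [Var 1] and v_(k+1), for 0 <= k < l,
   is [Var (l - k).+1]; m_(k+1) is [nth 0 ms k]. *)
Definition M16 (n : nat) (ms : seq nat) : form :=
  iter (size ms) All
    (Ex (All (big_and (mkseq (fun k =>
       Neg (Eq (Mul (pow (Var 1) n) (Var (size ms - k).+1))
               (pow (Var 0) (nth 0 ms k)))) (size ms))))).

Inductive mul_theory : theory :=
  | ax_M1 : mul_theory M1
  | ax_M2 : mul_theory M2
  | ax_M3 : mul_theory M3
  | ax_M4 : mul_theory M4
  | ax_M7 n : 1 <= n -> mul_theory (M7 n)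
  | ax_M16 n ms :
      1 <= n -> 1 <= size ms ->
      (forall m, m \in ms -> 0 < m /\ ~~ (m %| n)) ->
      mul_theory (M16 n ms).

(* Main.v *)
From HB Require Import structures.
From mathcomp Require Import all_boot all_order all_algebra.
From mathcomp Require Import boolp.
From mathcomp Require Import zify ring.
Require Import Defs.

Set Implicit Arguments.
Unset Strict Implicit.
Unset Printing Implicit Defensive.

Import Order.TTheory GRing.Theory Num.Theory.

(** The positive rationals satisfy the axioms, so provable sentences are true.
    For the converse it is enough that all models of the axioms satisfy the
    same sentences as Q+: Goedel's completeness theorem then turns a sentence
    true in Q+, hence in all models, into a provable one.

    Completeness ([completeness]) is proved by Henkin's construction. The
    language has no spare constants, so variables serve as witnesses: the
    axioms are sentences, each stage of the construction adds finitely many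
    formulas, and so a variable fresh for everything present always exists.
    The model consists of terms modulo provable equality.

    A model is written additively as a torsion-free abelian group in which, by
    the axioms [M16] with n = 1, finitely many cosets v + mG with m > 1 never cover
    the group. Two families a, b of r elements in such groups G, H are
    called N-similar if they satisfy the same relations n | k_1 a_1 + ... + k_r a_r
    with |k_i|, n <= N, where n = 0 expresses an equation. The core is the
    back-and-forth step [similar_extension]: for each r and N there is N' such
    that if a and b are N'-similar, every c in G has a partner d in H for which
    (c, a) and (d, b) are N-similar.
    - If c satisfies an equation p c = k.a with 0 < p <= N, then p divides k.b and
      d is the quotient. By torsion-freeness every relation on (c, a) is
      equivalent to one on a alone, with larger coefficients.
    - Otherwise put L = N!. By torsion-freeness all divisibilities by n <= N
      become divisibilities by L. The coefficients k_0 occurring in a relation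
      L | k_0 c + k.a are the multiples of some divisor e of L. From
      L | e c + h.a follows e | h.b, say e d0 = - h.b, and then every
      d = d0 + (L/e) x satisfies those of the relations that (c, a) satisfies;
      x is chosen to avoid the finitely many
      relations that (c, a) does not satisfy ([avoids_bounded]). Each of these
      excludes for x at most one coset of some mH with m > 1
      ([linear_congruence]).

    By induction on formulas, similarity for a large enough N determines the
    truth of a given formula ([sat_determined]). All models agree on sentences,
    because empty families are N-similar for all N.

    In Q+, [M16] holds because one may take for x a prime p not occurring in the
    v_k: in p^n v_k = z^m the p-adic valuation of the left side is n, and that of
    the right side is a multiple of m. *)

(** * Substitution *)

(** Terms bind no variables, so substitutions compose without any detour
    through renamings; the rest follows by going under quantifiers with [up]. *)
Lemma term_subst_comp sigma tau t :
  term_subst tau (term_subst sigma t) = term_subst (term_subst tau \o sigma) t.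
Proof. by elim: t => //= [s -> u ->|s ->]. Qed.

Lemma up_comp sigma tau :
  term_subst (up tau) \o up sigma = up (term_subst tau \o sigma).
Proof. by apply/funext; case=> //= i; rewrite !term_subst_comp. Qed.

Lemma subst_comp sigma tau phi :
  subst tau (subst sigma phi) = subst (term_subst tau \o sigma) phi.
Proof.
elim: phi sigma tau => //=.
- by move=> s t sigma tau; rewrite !term_subst_comp.
- by move=> a IHa b IHb sigma tau; rewrite IHa IHb.
- by move=> a IHa b IHb sigma tau; rewrite IHa IHb.
- by move=> a IHa b IHb sigma tau; rewrite IHa IHb.
- by move=> a IHa sigma tau; rewrite IHa up_comp.
- by move=> a IHa sigma tau; rewrite IHa up_comp.
Qed.

Lemma term_subst_agree n sigma tau t : (forall i, i < n -> sigma i = tau i) ->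
  term_closed n t -> term_subst sigma t = term_subst tau t.
Proof.
move=> agree; elim: t => /= [i||s IHs u IHu|s IHs].
- exact: agree.
- by [].
- by case/andP=> /IHs -> /IHu ->.
- by move/IHs ->.
Qed.

Lemma subst_agree n sigma tau phi : (forall i, i < n -> sigma i = tau i) ->
  closed n phi -> subst sigma phi = subst tau phi.
Proof.
have agree_up m s t : (forall i, i < m -> s i = t i) ->
    forall i, i < m.+1 -> up s i = up t i.
  by move=> agree [|i] //= /agree ->.
elim: phi n sigma tau => //=.
- by move=> s t n sigma tau agree /andP[cs ct]; rewrite !(term_subst_agree agree).
- by move=> a IHa b IHb n sigma tau agree /andP[ca cb];
    rewrite (IHa _ _ _ agree) ?(IHb _ _ _ agree).
- by move=> a IHa b IHb n sigma tau agree /andP[ca cb];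
    rewrite (IHa _ _ _ agree) ?(IHb _ _ _ agree).
- by move=> a IHa b IHb n sigma tau agree /andP[ca cb];
    rewrite (IHa _ _ _ agree) ?(IHb _ _ _ agree).
- by move=> a IHa n sigma tau /agree_up agree ca; rewrite (IHa _ _ _ agree).
- by move=> a IHa n sigma tau /agree_up agree ca; rewrite (IHa _ _ _ agree).
Qed.

Lemma term_subst_Var t : term_subst Var t = t.
Proof. by elim: t => //= [s -> u ->|s ->]. Qed.

Lemma up_Var : up Var = Var.
Proof. by apply/funext; case. Qed.

Lemma subst_Var phi : subst Var phi = phi.
Proof.
elim: phi => //= [s t|a -> b ->|a -> b ->|a -> b ->|a IHa|a IHa] //.
- by rewrite !term_subst_Var.
- by rewrite up_Var IHa.
- by rewrite up_Var IHa.
Qed.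

Lemma inst_up sigma t phi : inst t (subst (up sigma) phi) = subst (scons t sigma) phi.
Proof.
rewrite /inst subst_comp; congr subst; apply/funext; case=> //= i.
by rewrite term_subst_comp -[RHS]term_subst_Var.
Qed.

Lemma subst_inst sigma t phi :
  subst sigma (inst t phi) = inst (term_subst sigma t) (subst (up sigma) phi).
Proof.
rewrite inst_up /inst subst_comp; congr subst.
by apply/funext; case.
Qed.

Lemma subst_shift sigma phi :
  subst (up sigma) (shift phi) = shift (subst sigma phi).
Proof.
by rewrite /shift !subst_comp; congr subst; apply/funext => i.
Qed.

Lemma term_closed_leq m n t : m <= n -> term_closed m t -> term_closed n t.
Proof.
move=> le_mn; elim: t => //= [i /leq_trans -> //|s IHs u IHu].
by case/andP=> /IHs -> /IHu.
Qed.

Lemma closed_leq m n phi : m <= n -> closed m phi -> closed n phi.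
Proof.
elim: phi m n => //=.
- by move=> s t m n le_mn /andP[/(term_closed_leq le_mn)-> /(term_closed_leq le_mn)].
- by move=> a IHa b IHb m n le_mn /andP[/(IHa _ _ le_mn)-> /(IHb _ _ le_mn)].
- by move=> a IHa b IHb m n le_mn /andP[/(IHa _ _ le_mn)-> /(IHb _ _ le_mn)].
- by move=> a IHa b IHb m n le_mn /andP[/(IHa _ _ le_mn)-> /(IHb _ _ le_mn)].
- by move=> a IHa m n le_mn; apply: IHa.
- by move=> a IHa m n le_mn; apply: IHa.
Qed.

Lemma term_closed_exists t : exists n, term_closed n t.
Proof.
elim: t => /= [i||s [m cs] u [n cu]|s IHs //]; [by exists i.+1| by exists 0|].
exists (maxn m n); by rewrite (term_closed_leq _ cs) ?leq_maxl // (term_closed_leq _ cu) ?leq_maxr.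
Qed.

Lemma closed_exists phi : exists n, closed n phi.
Proof.
have both (a b : form) : (exists n, closed n a) -> (exists n, closed n b) ->
    exists n, closed n a && closed n b.
  move=> [m ca] [n cb]; exists (maxn m n).
  by rewrite (closed_leq _ ca) ?leq_maxl // (closed_leq _ cb) ?leq_maxr.
elim: phi => /=.
- by exists 0.
- move=> s t; have [m cs] := term_closed_exists s; have [n ct] := term_closed_exists t.
  exists (maxn m n).
  by rewrite (term_closed_leq _ cs) ?leq_maxl // (term_closed_leq _ ct) ?leq_maxr.
- by move=> a IHa b IHb; apply: both.
- by move=> a IHa b IHb; apply: both.
- by move=> a IHa b IHb; apply: both.
- by move=> a [n ca]; exists n; apply: closed_leq ca.
- by move=> a [n ca]; exists n; apply: closed_leq ca.
Qed.

Lemma term_closed_subst m n sigma t : (forall i, i < m -> term_closed n (sigma i)) ->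
  term_closed m t -> term_closed n (term_subst sigma t).
Proof.
move=> cl; elim: t => //= s IHs u IHu.
by case/andP=> /IHs -> /IHu.
Qed.

Lemma closed_subst m n sigma phi : (forall i, i < m -> term_closed n (sigma i)) ->
  closed m phi -> closed n (subst sigma phi).
Proof.
have cl_up p q s : (forall i, i < p -> term_closed q (s i)) ->
    forall i, i < p.+1 -> term_closed q.+1 (up s i).
  by move=> cl [|i] //= /cl; apply: term_closed_subst => j.
elim: phi m n sigma => //=.
- by move=> s t m n sigma cl /andP[cs ct]; rewrite !(term_closed_subst cl).
- by move=> a IHa b IHb m n sigma cl /andP[ca cb]; rewrite (IHa _ _ _ cl) ?(IHb _ _ _ cl).
- by move=> a IHa b IHb m n sigma cl /andP[ca cb]; rewrite (IHa _ _ _ cl) ?(IHb _ _ _ cl).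
- by move=> a IHa b IHb m n sigma cl /andP[ca cb]; rewrite (IHa _ _ _ cl) ?(IHb _ _ _ cl).
- by move=> a IHa m n sigma cl; apply: IHa; apply: cl_up.
- by move=> a IHa m n sigma cl; apply: IHa; apply: cl_up.
Qed.

(** * Derivations and soundness *)

Lemma nd_weaken G G' phi : {subset G <= G'} -> nd G phi -> nd G' phi.
Proof.
move=> + d; elim: d G' => {G phi}.
- by move=> G phi inG G' /(_ _ inG); apply: nd_Hyp.
- move=> G phi _ IH G' sub; apply: nd_Raa; apply: IH => psi.
  by rewrite !inE => /orP[->//|/sub ->]; rewrite orbT.
- move=> G phi psi _ IH G' sub; apply: nd_ImpI; apply: IH => chi.
  by rewrite !inE => /orP[->//|/sub ->]; rewrite orbT.
- move=> G phi psi _ IH1 _ IH2 G' sub.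
  by apply: nd_ImpE (IH1 _ sub) (IH2 _ sub).
- by move=> G phi psi _ IH1 _ IH2 G' sub; apply: nd_AndI; auto.
- by move=> G phi psi _ IH G' sub; apply: nd_AndEl (IH _ sub).
- by move=> G phi psi _ IH G' sub; apply: nd_AndEr (IH _ sub).
- by move=> G phi psi _ IH G' sub; apply: nd_OrIl (IH _ sub).
- by move=> G phi psi _ IH G' sub; apply: nd_OrIr (IH _ sub).
- move=> G phi psi chi _ IH _ IH1 _ IH2 G' sub; apply: nd_OrE (IH _ sub) _ _.
    by apply: IH1 => xi; rewrite !inE => /orP[->//|/sub ->]; rewrite orbT.
  by apply: IH2 => xi; rewrite !inE => /orP[->//|/sub ->]; rewrite orbT.
- move=> G phi _ IH G' sub; apply: nd_AllI; apply: IH => psi.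
  by case/mapP=> chi /sub inG' ->; apply: map_f.
- by move=> G phi t _ IH G' sub; apply: nd_AllE (IH _ sub).
- by move=> G phi t _ IH G' sub; apply: nd_ExI (IH _ sub).
- move=> G phi psi _ IH1 _ IH2 G' sub; apply: nd_ExE (IH1 _ sub) _.
  apply: IH2 => chi; rewrite !inE => /orP[->//|/mapP[xi /sub inG' ->]].
  by rewrite map_f ?orbT.
- by move=> G t G' _; apply: nd_EqI.
- by move=> G phi s t _ IH1 _ IH2 G' sub; apply: nd_EqE (IH1 _ sub) (IH2 _ sub).
Qed.

Lemma nd_subst sigma G phi : nd G phi -> nd (map (subst sigma) G) (subst sigma phi).
Proof.
move=> d; elim: d sigma => {G phi} /=.
- by move=> G phi inG sigma; apply: nd_Hyp; apply: map_f.
- by move=> G phi _ IH sigma; apply: nd_Raa; apply: IH.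
- by move=> G phi psi _ IH sigma; apply: nd_ImpI; apply: IH.
- by move=> G phi psi _ IH1 _ IH2 sigma; apply: nd_ImpE (IH1 sigma) (IH2 sigma).
- by move=> G phi psi _ IH1 _ IH2 sigma; apply: nd_AndI.
- by move=> G phi psi _ IH sigma; apply: nd_AndEl (IH sigma).
- by move=> G phi psi _ IH sigma; apply: nd_AndEr (IH sigma).
- by move=> G phi psi _ IH sigma; apply: nd_OrIl.
- by move=> G phi psi _ IH sigma; apply: nd_OrIr.
- by move=> G phi psi chi _ IH _ IH1 _ IH2 sigma; apply: nd_OrE (IH sigma) (IH1 sigma) (IH2 sigma).
- move=> G phi _ IH sigma; apply: nd_AllI; have := IH (up sigma).
  by rewrite -!map_comp (eq_map (subst_shift sigma)).
- by move=> G phi t _ IH sigma; rewrite subst_inst; apply: nd_AllE (IH sigma).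
- move=> G phi t _ IH sigma; apply: nd_ExI (term_subst sigma t) _.
  by rewrite -subst_inst.
- move=> G phi psi _ IH1 _ IH2 sigma; apply: nd_ExE (IH1 sigma) _.
  have := IH2 (up sigma).
  by rewrite -!map_comp (eq_map (subst_shift sigma)) subst_shift.
- by move=> G t sigma; apply: nd_EqI.
- move=> G phi s t _ IH1 _ IH2 sigma; rewrite subst_inst.
  by apply: nd_EqE (IH1 sigma) _; rewrite -subst_inst.
Qed.

Lemma eval_subst (M : structure) (rho : nat -> M) sigma t :
  eval rho (term_subst sigma t) = eval (eval rho \o sigma) t.
Proof. by elim: t => //= [s -> u ->|s ->]. Qed.

Lemma env_cons_up (M : structure) (rho : nat -> M) (d : M) sigma :
  eval (env_cons d rho) \o up sigma = env_cons d (eval rho \o sigma).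
Proof. by apply/funext; case=> //= i; rewrite eval_subst. Qed.

Lemma sat_subst (M : structure) (rho : nat -> M) sigma phi :
  sat rho (subst sigma phi) <-> sat (eval rho \o sigma) phi.
Proof.
elim: phi rho sigma => //=.
- by move=> s t rho sigma; rewrite !eval_subst.
- by move=> a IHa b IHb rho sigma; rewrite IHa IHb.
- by move=> a IHa b IHb rho sigma; rewrite IHa IHb.
- by move=> a IHa b IHb rho sigma; rewrite IHa IHb.
- move=> a IHa rho sigma; split=> H d; first by rewrite -env_cons_up; apply/IHa.
  by apply/IHa; rewrite env_cons_up.
- move=> a IHa rho sigma; split=> -[d H]; exists d.
    by rewrite -env_cons_up; apply/IHa.
  by apply/IHa; rewrite env_cons_up.
Qed.

Lemma sat_shift (M : structure) (rho : nat -> M) d phi :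
  sat (env_cons d rho) (shift phi) <-> sat rho phi.
Proof. exact: sat_subst. Qed.

Lemma sat_inst (M : structure) (rho : nat -> M) t phi :
  sat rho (inst t phi) <-> sat (env_cons (eval rho t) rho) phi.
Proof.
rewrite sat_subst; suff -> : eval rho \o scons t Var = env_cons (eval rho t) rho by [].
by apply/funext; case.
Qed.

Lemma nd_sound (M : structure) G phi : nd G phi ->
  forall rho : nat -> M, (forall psi, psi \in G -> sat rho psi) -> sat rho phi.
Proof.
have satG (rho : nat -> M) psi G' : sat rho psi -> (forall chi, chi \in G' -> sat rho chi) ->
    forall chi, chi \in psi :: G' -> sat rho chi.
  by move=> ? HG chi; rewrite inE => /orP[/eqP-> //|/HG].
have satS (rho : nat -> M) d G' : (forall chi, chi \in G' -> sat rho chi) ->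
    forall chi, chi \in map shift G' -> sat (env_cons d rho) chi.
  by move=> HG _ /mapP[chi /HG Hchi ->]; apply/sat_shift.
elim=> {G phi} /=.
- by move=> G phi inG rho; apply.
- by move=> G phi _ IH rho HG; apply: contrapT => Nphi; apply: (IH rho); apply: satG.
- by move=> G phi psi _ IH rho HG Hphi; apply: IH; apply: satG.
- by move=> G phi psi _ IH1 _ IH2 rho HG; apply: (IH1 rho HG) (IH2 rho HG).
- by move=> G phi psi _ IH1 _ IH2 rho HG; split; [apply: IH1|apply: IH2].
- by move=> G phi psi _ IH rho /IH[].
- by move=> G phi psi _ IH rho /IH[].
- by move=> G phi psi _ IH rho /IH; left.
- by move=> G phi psi _ IH rho /IH; right.
- move=> G phi psi chi _ IH _ IH1 _ IH2 rho HG.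
  by case: (IH rho HG) => ?; [apply: IH1|apply: IH2]; apply: satG.
- by move=> G phi _ IH rho HG d; apply: IH; apply: satS.
- by move=> G phi t _ IH rho HG; apply/sat_inst; apply: IH.
- by move=> G phi t _ IH rho /IH /sat_inst; exists (eval rho t).
- move=> G phi psi _ IH1 _ IH2 rho HG; have [d Hd] := IH1 rho HG.
  by apply/(sat_shift rho d); apply: IH2; apply: satG => //; apply: satS.
- by [].
- move=> G phi s t _ IH1 _ IH2 rho HG; apply/sat_inst.
  by rewrite -(IH1 rho HG); apply/sat_inst; apply: IH2.
Qed.

Definition models (M : structure) (T : theory) : Prop :=
  forall psi, T psi -> true_in M psi.

Lemma provable_sound (M : structure) (T : theory) phi :
  models M T -> provable T phi -> true_in M phi.
Proof.
move=> MT [G GT d] rho; apply: (nd_sound d) => psi /GT Tpsi.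
exact: MT.
Qed.

(** * Enumeration of formulas *)

Fixpoint term_tree (t : term) : GenTree.tree nat :=
  match t with
  | Var i => GenTree.Leaf i
  | One => GenTree.Node 0 [::]
  | Mul s u => GenTree.Node 1 [:: term_tree s; term_tree u]
  | Inv s => GenTree.Node 2 [:: term_tree s]
  end.

Fixpoint tree_term (T : GenTree.tree nat) : term :=
  match T with
  | GenTree.Leaf i => Var i
  | GenTree.Node 1 [:: s; u] => Mul (tree_term s) (tree_term u)
  | GenTree.Node 2 [:: s] => Inv (tree_term s)
  | _ => One
  end.

Lemma term_treeK : cancel term_tree tree_term.
Proof. by elim=> //= [s -> u ->|s ->]. Qed.

Fixpoint form_tree (phi : form) : GenTree.tree nat :=
  match phi with
  | Bot => GenTree.Node 0 [::]
  | Eq s t => GenTree.Node 1 [:: term_tree s; term_tree t]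
  | Imp a b => GenTree.Node 2 [:: form_tree a; form_tree b]
  | And a b => GenTree.Node 3 [:: form_tree a; form_tree b]
  | Or a b => GenTree.Node 4 [:: form_tree a; form_tree b]
  | All a => GenTree.Node 5 [:: form_tree a]
  | Ex a => GenTree.Node 6 [:: form_tree a]
  end.

Fixpoint tree_form (T : GenTree.tree nat) : form :=
  match T with
  | GenTree.Node 1 [:: s; t] => Eq (tree_term s) (tree_term t)
  | GenTree.Node 2 [:: a; b] => Imp (tree_form a) (tree_form b)
  | GenTree.Node 3 [:: a; b] => And (tree_form a) (tree_form b)
  | GenTree.Node 4 [:: a; b] => Or (tree_form a) (tree_form b)
  | GenTree.Node 5 [:: a] => All (tree_form a)
  | GenTree.Node 6 [:: a] => Ex (tree_form a)
  | _ => Bot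
  end.

Lemma form_treeK : cancel form_tree tree_form.
Proof.
elim=> //= [s t|a -> b ->|a -> b ->|a -> b ->|a ->|a ->] //.
by rewrite !term_treeK.
Qed.

Definition nth_form (n : nat) : form :=
  if unpickle n is Some T then tree_form T else Bot.

Lemma nth_form_surj phi : exists n, nth_form n = phi.
Proof.
by exists (pickle (form_tree phi)); rewrite /nth_form pickleK form_treeK.
Qed.

(** * Extensions of theories *)

Definition add (phi : form) (T : theory) : theory := fun psi => psi = phi \/ T psi.

Definition consistent (T : theory) : Prop := ~ provable T Bot.

Lemma provable_ax (T : theory) phi : T phi -> provable T phi.
Proof.
move=> Tphi; exists [:: phi]; first by move=> psi; rewrite inE => /eqP ->.
by apply: nd_Hyp; rewrite inE.
Qed.

Lemma provable_nd (T : theory) G phi :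
  (forall psi, psi \in G -> provable T psi) -> nd G phi -> provable T phi.
Proof.
elim: G phi => [|psi G IH] phi GT d; first by exists [::].
have [G1 G1T d1] : provable T (Imp psi phi).
  apply: IH (nd_ImpI d) => chi inG; apply: GT.
  by rewrite inE inG orbT.
have [G2 G2T d2] : provable T psi by apply: GT; rewrite inE eqxx.
exists (G1 ++ G2).
  by move=> chi; rewrite mem_cat => /orP[/G1T|/G2T].
apply: (nd_ImpE (phi := psi)).
  by apply: nd_weaken d1 => chi inG; rewrite mem_cat inG.
by apply: nd_weaken d2 => chi inG; rewrite mem_cat inG orbT.
Qed.

Lemma deduction (T : theory) phi psi :
  provable (add phi T) psi -> provable T (Imp phi psi).
Proof.
move=> [G GT d]; exists [seq chi <- G | chi != phi].
  move=> chi; rewrite mem_filter => /andP[neq /GT[eq|//]].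
  by rewrite eq eqxx in neq.
apply: nd_ImpI; apply: nd_weaken d => chi inG.
by rewrite inE mem_filter inG andbT; case: eqP.
Qed.

Lemma provable_sub (T U : theory) phi :
  (forall psi, T psi -> U psi) -> provable T phi -> provable U phi.
Proof. by move=> sub [G GT d]; exists G => // psi /GT/sub. Qed.

Lemma consistent_addN (T : theory) phi :
  ~ provable T phi -> consistent (add (Neg phi) T).
Proof.
move=> Nphi /deduction H; apply: Nphi.
apply: (@provable_nd _ [:: Neg (Neg phi)]).
  by move=> psi; rewrite inE => /eqP ->.
by apply: nd_Raa; apply: (nd_ImpE (phi := Neg phi)); apply: nd_Hyp; rewrite !inE eqxx ?orbT.
Qed.

(** The variable [Var N] occurs neither in T nor in chi, so a contradiction
    derived from the instance at [Var N] turns, on renaming [Var N] to [Var 0] and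
    shifting all other variables, into the premise of existential elimination. *)
Lemma consistent_witness (T : theory) N chi :
  (forall psi, T psi -> closed N psi) -> closed N (Ex chi) -> T (Ex chi) ->
  consistent T -> consistent (add (inst (Var N) chi) T).
Proof.
move=> cT cchi Tchi conT /deduction[G GT /(nd_subst
  (fun i => if i == N then Var 0 else Var i.+1)) d]; apply: conT.
have shiftG psi : closed N psi ->
    subst (fun i => if i == N then Var 0 else Var i.+1) psi = shift psi.
  by apply: subst_agree => i; rewrite ltn_neqAle => /andP[/negPf ->].
exists (Ex chi :: G).
  by move=> psi; rewrite inE => /orP[/eqP->|/GT].
apply: (@nd_ExE _ chi); first by apply: nd_Hyp; rewrite inE eqxx.
apply: (nd_ImpE (phi := chi)); last by apply: nd_Hyp; rewrite inE eqxx.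
rewrite -[X in Imp X]subst_Var.
rewrite (_ : map _ _ = map shift G) in d; last first.
  by apply/eq_in_map => psi /GT/cT/shiftG.
move: d => /=; rewrite -/(Neg Bot) subst_inst /= eqxx inst_up.
rewrite (@subst_agree N.+1 _ Var) //.
  apply: nd_weaken => psi inG; by rewrite !inE inG !orbT.
by move=> [|i] //=; rewrite ltnS ltn_neqAle => /andP[/negPf ->].
Qed.

Definition bound (phi : form) : nat := xchoose (closed_exists phi).

Lemma closed_bound phi : closed (bound phi) phi.
Proof. exact: (xchooseP (closed_exists phi)). Qed.

(** The second component bounds the free variables of the theory. It supplies
    the fresh witness for an existential formula and is raised past it. *)
Definition extend (TN : theory * nat) (psi : form) : theory * nat :=
  let: (T, N) := TN in
  if `[< consistent (add psi T) >] then
    let N' := maxn N (bound psi) in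
    if psi is Ex chi then (add (inst (Var N') chi) (add psi T), N'.+1)
    else (add psi T, N')
  else (T, N).

Lemma extend_sub TN psi phi : TN.1 phi -> (extend TN psi).1 phi.
Proof.
case: TN => T N /= Tphi; case: ifP => // _.
by case: psi => * /=; rewrite /add; auto.
Qed.

Lemma extend_in TN psi : consistent (add psi TN.1) -> (extend TN psi).1 psi.
Proof.
case: TN => T N /= /asboolP ->.
by case: psi => * /=; rewrite /add; auto.
Qed.

Lemma extend_witness TN chi : consistent (add (Ex chi) TN.1) ->
  exists t, (extend TN (Ex chi)).1 (inst t chi).
Proof.
case: TN => T N /= /asboolP -> /=.
by exists (Var (maxn N (bound (Ex chi)))); left.
Qed.

Definition fresh_consistent (TN : theory * nat) : Prop :=
  (forall psi, TN.1 psi -> closed TN.2 psi) /\ consistent TN.1.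

Lemma extend_fresh_consistent TN psi : fresh_consistent TN -> fresh_consistent (extend TN psi).
Proof.
case: TN => T N [/= cT conT]; case: ifP => // /asboolP con.
have := closed_bound psi; move: (bound psi) => b cb; set N' := maxn N b.
have cadd chi : add psi T chi -> closed N' chi.
  case=> [->|/cT]; first by apply: closed_leq cb; apply: leq_maxr.
  by apply: closed_leq; apply: leq_maxl.
have goodN : fresh_consistent (add psi T, N') by [].
case: psi con cb cadd goodN => // chi con cb cadd goodN.
have cN : closed N' (Ex chi) by apply: cadd; left.
split=> /=; last by apply: consistent_witness => //; left.
move=> psi [->|/cadd]; last exact: closed_leq.
apply: (@closed_subst N'.+1) => //; case=> //= i lt_iN.
exact: ltnW.
Qed.

Fixpoint stage (T : theory) (n : nat) : theory * nat :=
  if n is m.+1 then extend (stage T m) (nth_form m) else (T, 0).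

Definition completion (T : theory) : theory :=
  fun phi => exists n, (stage T n).1 phi.

(** * The Henkin model *)

Section Henkin.

Variable T : theory.
Hypothesis sentT : forall psi, T psi -> sentence psi.
Hypothesis conT : consistent T.

Let D := completion T.

Lemma stage_fresh_consistent n : fresh_consistent (stage T n).
Proof. by elim: n => [|n IH] /=; [split|apply: extend_fresh_consistent]. Qed.

Lemma stage_mono m n phi : m <= n -> (stage T m).1 phi -> (stage T n).1 phi.
Proof.
elim: n => [|n IH]; first by rewrite leqn0 => /eqP ->.
rewrite leq_eqVlt => /orP[/eqP->//|/IH{}IH /IH]; exact: extend_sub.
Qed.

Lemma completion_finite (G : seq form) : (forall psi, psi \in G -> D psi) ->
  exists n, forall psi, psi \in G -> (stage T n).1 psi.
Proof.
elim: G => [|phi G IH] GD; first by exists 0.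
have [n Hn] : exists n, forall psi, psi \in G -> (stage T n).1 psi.
  by apply: IH => psi inG; apply: GD; rewrite inE inG orbT.
have [m Hm] := GD phi (mem_head _ _).
exists (maxn m n) => psi; rewrite inE => /orP[/eqP->|/Hn].
  by apply: stage_mono Hm; apply: leq_maxl.
by apply: stage_mono; apply: leq_maxr.
Qed.

Lemma completion_consistent : consistent D.
Proof.
move=> [G /completion_finite[n Gn] d].
by case: (stage_fresh_consistent n) => _; apply; exists G.
Qed.

(** A formula consistent with the completion is consistent with the stage at
    which it is considered, and is added there. *)
Lemma completion_maximal phi : consistent (add phi D) -> D phi.
Proof.
move=> con; have [n en] := nth_form_surj phi.
exists n.+1; rewrite /= en; apply: extend_in => pr; apply: con.
by apply: provable_sub pr => psi [->|Hn]; [left|right; exists n].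
Qed.

Lemma completion_witness chi : D (Ex chi) -> exists t, D (inst t chi).
Proof.
move=> DEx; have [n en] := nth_form_surj (Ex chi).
have [|t Ht] := @extend_witness (stage T n) chi; last first.
  by exists t; exists n.+1; rewrite /= en.
move=> pr; apply: completion_consistent.
by apply: provable_sub pr => psi [->|Hn] //; exists n.
Qed.

Lemma completion_provable phi : provable D phi -> D phi.
Proof.
move=> pr; apply: completion_maximal => /deduction pr'.
apply: completion_consistent.
apply: (@provable_nd _ [:: phi; Neg phi]).
  by move=> psi; rewrite !inE => /orP[] /eqP ->.
by apply: (nd_ImpE (phi := phi)); apply: nd_Hyp; rewrite !inE eqxx ?orbT.
Qed.

Lemma completion_nd G phi : (forall psi, psi \in G -> D psi) -> nd G phi -> D phi.
Proof.
move=> GD d; apply: completion_provable; apply: provable_nd d => psi /GD.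
exact: provable_ax.
Qed.

Lemma completion_nd1 a phi : D a -> nd [:: a] phi -> D phi.
Proof.
by move=> Da; apply: completion_nd => psi; rewrite !inE => /eqP ->.
Qed.

Lemma completion_nd2 a b phi : D a -> D b -> nd [:: a; b] phi -> D phi.
Proof.
by move=> Da Db; apply: completion_nd => psi; rewrite !inE => /orP[] /eqP ->.
Qed.

Lemma completion_neg phi : D (Neg phi) <-> ~ D phi.
Proof.
split=> [DN Dphi|NDphi].
  apply: completion_consistent; apply: provable_ax.
  apply: (completion_nd2 DN Dphi); apply: (nd_ImpE (phi := phi));
    by apply: nd_Hyp; rewrite !inE eqxx ?orbT.
apply: completion_provable; apply: deduction.
by apply: contrapT => con; apply/NDphi/completion_maximal.
Qed.

Lemma completion_Bot : ~ D Bot.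
Proof. by move/provable_ax; apply: completion_consistent. Qed.

Lemma completion_Imp a b : D (Imp a b) <-> (D a -> D b).
Proof.
split=> [Dab Da|Dab].
  apply: (completion_nd2 Dab Da); apply: (nd_ImpE (phi := a));
    by apply: nd_Hyp; rewrite !inE eqxx ?orbT.
have [/Dab Db|/completion_neg DNa] := pselect (D a).
  apply: (completion_nd1 Db); apply: nd_ImpI.
  by apply: nd_Hyp; rewrite !inE eqxx ?orbT.
apply: (completion_nd1 DNa); apply: nd_ImpI; apply: nd_Raa.
by apply: (nd_ImpE (phi := a)); apply: nd_Hyp; rewrite !inE eqxx ?orbT.
Qed.

Lemma completion_And a b : D (And a b) <-> D a /\ D b.
Proof.
split=> [Dab|[Da Db]].
  split; apply: (completion_nd1 Dab).
    by apply: (@nd_AndEl _ a b); apply: nd_Hyp; rewrite mem_head.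
  by apply: (@nd_AndEr _ a b); apply: nd_Hyp; rewrite mem_head.
apply: (completion_nd2 Da Db).
by apply: nd_AndI; apply: nd_Hyp; rewrite !inE eqxx ?orbT.
Qed.

Lemma completion_Or a b : D (Or a b) <-> D a \/ D b.
Proof.
split=> [Dab|[Da|Db]].
- apply: contrapT => /not_orP[/completion_neg DNa /completion_neg DNb].
  apply: completion_Bot; apply: (@completion_nd [:: Or a b; Neg a; Neg b]).
    by move=> psi; rewrite !inE => /or3P[] /eqP ->.
  apply: (@nd_OrE _ a b); first by apply: nd_Hyp; rewrite !inE eqxx.
    by apply: (nd_ImpE (phi := a)); apply: nd_Hyp; rewrite !inE eqxx ?orbT.
  by apply: (nd_ImpE (phi := b)); apply: nd_Hyp; rewrite !inE eqxx ?orbT.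
- by apply: (completion_nd1 Da); apply: nd_OrIl; apply: nd_Hyp; rewrite mem_head.
- by apply: (completion_nd1 Db); apply: nd_OrIr; apply: nd_Hyp; rewrite mem_head.
Qed.

Lemma completion_Ex a : D (Ex a) <-> exists t, D (inst t a).
Proof.
split=> [/completion_witness//|[t Dt]]; apply: (completion_nd1 Dt).
by apply: (@nd_ExI _ _ t); apply: nd_Hyp; rewrite mem_head.
Qed.

(** If All a is not in D, then its negation is, whence Ex (Neg a) and, by the
    witness property, some Neg a[t]. *)
Lemma completion_All a : D (All a) <-> forall t, D (inst t a).
Proof.
split=> [Da t|Da].
  by apply: (completion_nd1 Da); apply: nd_AllE; apply: nd_Hyp; rewrite mem_head.
apply: contrapT => /completion_neg DN.
have /completion_Ex[t /completion_neg[]] : D (Ex (Neg a)); last exact: Da.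
apply: (completion_nd1 DN); apply: nd_Raa.
apply: (nd_ImpE (phi := All a)); first by apply: nd_Hyp; rewrite !inE eqxx orbT.
apply: nd_AllI; apply: nd_Raa => /=.
apply: (nd_ImpE (phi := shift (Ex (Neg a)))).
  by apply: nd_Hyp; rewrite !inE eqxx orbT.
apply: (@nd_ExI _ _ (Var 0)); rewrite /inst /= -/(inst (Var 0) _) inst_up.
rewrite (_ : scons _ _ = Var); last by apply/funext; case.
by rewrite subst_Var; apply: nd_Hyp; rewrite mem_head.
Qed.

Lemma completion_eq_refl t : D (Eq t t).
Proof. by apply: (@completion_nd [::]) => //; apply: nd_EqI. Qed.

Lemma completion_eqE s t phi : D (Eq s t) -> D (inst s phi) -> D (inst t phi).
Proof.
move=> Dst Ds; apply: (completion_nd2 Dst Ds).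
by apply: (@nd_EqE _ _ s); apply: nd_Hyp; rewrite !inE eqxx ?orbT.
Qed.

Lemma inst_shift_term s t : term_subst (scons s Var) (term_subst shift_var t) = t.
Proof. by rewrite term_subst_comp -[RHS]term_subst_Var. Qed.

Lemma completion_eq_sym s t : D (Eq s t) -> D (Eq t s).
Proof.
move=> Dst; have := @completion_eqE s t (Eq (Var 0) (term_subst shift_var s)) Dst.
by rewrite /inst /= !inst_shift_term; apply; apply: completion_eq_refl.
Qed.

Lemma completion_eq_trans s t u : D (Eq s t) -> D (Eq t u) -> D (Eq s u).
Proof.
move=> Dst Dtu; have := @completion_eqE t u (Eq (term_subst shift_var s) (Var 0)) Dtu.
by rewrite /inst /= !inst_shift_term; apply.
Qed.

Lemma completion_eq_Mul s s' t t' :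
  D (Eq s s') -> D (Eq t t') -> D (Eq (Mul s t) (Mul s' t')).
Proof.
move=> Ds Dt.
have := @completion_eqE s s' (Eq (term_subst shift_var (Mul s t))
  (Mul (Var 0) (term_subst shift_var t))) Ds.
rewrite /inst /= !inst_shift_term => /(_ (completion_eq_refl _)).
have := @completion_eqE t t' (Eq (term_subst shift_var (Mul s t))
  (Mul (term_subst shift_var s') (Var 0))) Dt.
by rewrite /inst /= !inst_shift_term.
Qed.

Lemma completion_eq_Inv s s' : D (Eq s s') -> D (Eq (Inv s) (Inv s')).
Proof.
move=> Ds.
have := @completion_eqE s s' (Eq (term_subst shift_var (Inv s)) (Inv (Var 0))) Ds.
by rewrite /inst /= !inst_shift_term; apply; apply: completion_eq_refl.
Qed.

Lemma representative_exists t :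
  exists S, `[< D (Eq t (tree_term S)) >].
Proof.
by exists (term_tree t); rewrite term_treeK; apply/asboolP/completion_eq_refl.
Qed.

(** A canonical member of the class of t for provable equality: the choice
    depends only on the extension of the predicate, so equal terms get the same
    representative and the quotient can be realised as a subtype of [term]. *)
Definition representative t := tree_term (xchoose (representative_exists t)).

Lemma representativeP t : D (Eq t (representative t)).
Proof. exact/asboolP/(xchooseP (representative_exists t)). Qed.

Lemma representative_eq s t : (representative s = representative t) <-> D (Eq s t).
Proof.
split=> [eq_st|Dst].
  apply: completion_eq_trans (representativeP s) _.
  by rewrite eq_st; apply/completion_eq_sym/representativeP.
congr tree_term; apply: eq_xchoose => S; apply/asboolP/asboolP.
  by apply: completion_eq_trans; apply: completion_eq_sym.
exact: completion_eq_trans.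
Qed.

Definition henkin_carrier := {t : term | representative t == t}.

Lemma representative_idem t : representative (representative t) == representative t.
Proof. by apply/eqP/representative_eq/completion_eq_sym/representativeP. Qed.

Definition class t : henkin_carrier := exist _ (representative t) (representative_idem t).

Definition henkin_model : structure :=
  @Structure henkin_carrier (fun x y => class (Mul (val x) (val y))) (class One)
    (fun x => class (Inv (val x))).

Lemma class_eq s t : class s = class t <-> D (Eq s t).
Proof.
by rewrite -representative_eq; split=> [/(congr1 val)//|eq_st]; apply: val_inj.
Qed.

Lemma class_val x : class (val x) = x.
Proof. by apply: val_inj; apply/eqP; apply: (valP x). Qed.

Lemma eval_henkin (rho : nat -> henkin_model) t :
  eval rho t = class (term_subst (fun i => val (rho i)) t).
Proof.
elim: t => //= [i|s -> u ->|s ->]; first by rewrite class_val.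
  apply/class_eq/completion_eq_sym.
  by apply: completion_eq_Mul; apply: representativeP.
by apply/class_eq/completion_eq_sym/completion_eq_Inv/representativeP.
Qed.

(** Quantifiers range over representatives in the model and over all terms in D;
    this lemma makes up for the difference. *)
Lemma completion_inst_val phi t :
  D (inst t phi) <-> D (inst (val (class t)) phi).
Proof.
have Dt := representativeP t; split; first exact: completion_eqE.
exact/completion_eqE/completion_eq_sym.
Qed.

(** Truth in the Henkin model is membership in D: each connective was shown to
    behave in D as its truth condition demands. *)
Lemma sat_henkin (rho : nat -> henkin_model) phi :
  sat rho phi <-> D (subst (fun i => val (rho i)) phi).
Proof.
have val_cons (r : nat -> henkin_model) (d : henkin_model) a :
    subst (fun i => val (env_cons d r i)) a
    = inst (val d) (subst (up (fun i => val (r i))) a).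
  by rewrite inst_up; congr subst; apply/funext; case.
elim: phi rho => /= [|s t|a IHa b IHb|a IHa b IHb|a IHa b IHb|a IHa|a IHa] rho.
- by split=> // /completion_Bot.
- by rewrite !eval_henkin class_eq.
- by rewrite completion_Imp IHa IHb.
- by rewrite completion_And IHa IHb.
- by rewrite completion_Or IHa IHb.
- rewrite completion_All; split=> H.
    by move=> t; apply/completion_inst_val; rewrite -val_cons; apply/IHa.
  by move=> d; apply/IHa; rewrite val_cons.
- rewrite completion_Ex; split=> [[d /IHa]|[t]].
    by rewrite val_cons; exists (val d).
  by move/completion_inst_val; rewrite -val_cons => /IHa; exists (class t).
Qed.

Lemma henkin_sentence phi : sentence phi -> true_in henkin_model phi <-> D phi.
Proof.
move=> sphi.
have sub_id (rho : nat -> henkin_model) : subst (fun i => val (rho i)) phi = phi.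
  by rewrite -[RHS]subst_Var; apply: subst_agree sphi.
split=> [/(_ (fun=> class One))/sat_henkin|Dphi rho]; first by rewrite sub_id.
by apply/sat_henkin; rewrite sub_id.
Qed.

End Henkin.

(** Goedel's completeness theorem. If phi is not provable, then T together with
    the negation of phi is consistent, and its Henkin model refutes phi. *)
Theorem completeness (T : theory) phi :
  (forall psi, T psi -> sentence psi) -> sentence phi ->
  (forall M : structure, models M T -> true_in M phi) -> provable T phi.
Proof.
move=> sentT sphi valid; apply: contrapT => /consistent_addN con.
have sent psi : add (Neg phi) T psi -> sentence psi.
  by case=> [->|/sentT //]; rewrite /sentence /= andbT.
have inD psi : add (Neg phi) T psi -> completion (add (Neg phi) T) psi by exists 0.
have Mphi : true_in (henkin_model sent con) phi.
  apply: valid => psi Tpsi; apply/henkin_sentence; first exact: sentT.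
  by apply: inD; right.
have : true_in (henkin_model sent con) (Neg phi).
  by apply/henkin_sentence; [apply: (sent); left|apply: inD; left].
pose rho (i : nat) : henkin_model sent con := class sent con One.
by move=> /(_ rho); apply; apply: Mphi.
Qed.

(** * Divisibility in torsion-free abelian groups *)

Section Groups.
Local Open Scope ring_scope.

Definition multiple (G : zmodType) (n : nat) (y : G) : Prop := exists z, y = z *+ n.

Definition torsion_free (G : zmodType) : Prop :=
  forall (x : G) n, (0 < n)%N -> x *+ n = 0 -> x = 0.

(** What [M16] says for n = 1: finitely many cosets - v + mG with m > 1 do not cover
    the group. *)
Definition avoids_cosets (G : zmodType) : Prop :=
  forall s : seq (G * nat), (forall p, p \in s -> (1 < p.2)%N) ->
  exists x, forall p, p \in s -> ~ multiple p.2 (x + p.1).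

Lemma multiple0 (G : zmodType) (y : G) : multiple 0 y <-> y = 0.
Proof. by split=> [[z ->]|->]; [|exists 0]; rewrite mulr0n. Qed.

Lemma multipleMn (G : zmodType) (y : G) n : multiple n (y *+ n).
Proof. by exists y. Qed.

Lemma multipleD (G : zmodType) (y z : G) n :
  multiple n y -> multiple n z -> multiple n (y + z).
Proof. by move=> [u ->] [v ->]; exists (u + v); rewrite mulrnDl. Qed.

Lemma multipleMz (G : zmodType) (y : G) n c : multiple n y -> multiple n (y *~ c).
Proof. by move=> [u ->]; exists (u *~ c); rewrite !pmulrn mulrzAC. Qed.

Lemma multipleDl (G : zmodType) (y z : G) n :
  multiple n y -> multiple n (y + z) <-> multiple n z.
Proof.
move=> my; split=> [myz|]; last exact: multipleD.
rewrite -[z](addKr y); apply: multipleD => //.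
by rewrite -mulrN1z; apply: multipleMz.
Qed.

Lemma multiple_dvd (G : zmodType) (y : G) m n :
  (m %| n)%N -> multiple n y -> multiple m y.
Proof. by case/dvdnP=> k -> [z ->]; exists (z *+ k); rewrite mulrnA. Qed.

Lemma multiple_Mz_dvd (G : zmodType) (y : G) (n : nat) (c : int) :
  (n %| c)%Z -> multiple n (y *~ c).
Proof. by case/dvdzP=> k ->; exists (y *~ k); rewrite mulrzA. Qed.

Lemma mulrn_inj (G : zmodType) (x y : G) n :
  torsion_free G -> (0 < n)%N -> x *+ n = y *+ n -> x = y.
Proof.
move=> tf n_gt0 eq_xy; apply/eqP; rewrite -subr_eq0; apply/eqP/(tf _ n) => //.
by rewrite mulrnBl eq_xy subrr.
Qed.

Lemma multipleM (G : zmodType) (y : G) m n : torsion_free G -> (0 < m)%N ->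
  multiple (m * n) (y *+ m) <-> multiple n y.
Proof.
move=> tf m_gt0; split=> [[z]|[z ->]]; last by exists z; rewrite -mulrnA mulnC.
by rewrite mulnC mulrnA => /(mulrn_inj tf m_gt0) ->; exists z.
Qed.

Definition lincomb (G : zmodType) r (k : nat -> int) (a : nat -> G) : G :=
  \sum_(i < r) a i *~ k i.

Definition bounded r N (k : nat -> int) : Prop := forall i, (i < r)%N -> (`|k i| <= N)%N.

(** [multiple 0] being equality to 0, the case n = 0 compares the linear equations
    satisfied by a and b. *)
Definition similar r N (G H : zmodType) (a : nat -> G) (b : nat -> H) : Prop :=
  forall k, bounded r N k -> forall n, (n <= N)%N ->
  multiple n (lincomb r k a) <-> multiple n (lincomb r k b).

Lemma similarW r N N' (G H : zmodType) (a : nat -> G) (b : nat -> H) :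
  (N <= N')%N -> similar r N' a b -> similar r N a b.
Proof.
move=> leN sim k bk n le_n; apply: sim; last exact: leq_trans leN.
by move=> i /bk /leq_trans; apply.
Qed.

Definition prepend (T : Type) (c : T) (a : nat -> T) (i : nat) : T :=
  if i is j.+1 then a j else c.

Lemma lincomb_cons (G : zmodType) r k (c : G) a :
  lincomb r.+1 k (prepend c a) = c *~ k 0%N + lincomb r (fun i => k i.+1) a.
Proof. by rewrite /lincomb big_ord_recl. Qed.

Lemma lincombD (G : zmodType) r k l (a : nat -> G) :
  lincomb r k a + lincomb r l a = lincomb r (fun i => k i + l i) a.
Proof. by rewrite /lincomb -big_split; apply: eq_bigr => i _; rewrite mulrzDr. Qed.

Lemma lincombMz (G : zmodType) r k (a : nat -> G) c :
  lincomb r k a *~ c = lincomb r (fun i => k i * c) a.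
Proof. by rewrite /lincomb mulrz_suml; apply: eq_bigr => i _; rewrite mulrzA. Qed.

Lemma lincombMn (G : zmodType) r k (a : nat -> G) (c : nat) :
  lincomb r k a *+ c = lincomb r (fun i => k i * c%:Z) a.
Proof. by rewrite pmulrn lincombMz. Qed.

Lemma lincombN (G : zmodType) r k (a : nat -> G) :
  - lincomb r k a = lincomb r (fun i => - k i) a.
Proof. by rewrite /lincomb -sumrN; apply: eq_bigr => i _; rewrite mulrNz. Qed.

(** The solutions x of n x + v = 0 mod m lie in a single coset of some m'G, m' > 1.
    With g = gcd(n, m) = u n + t m they exist only if v = g w, and then
    g (x + u w) = u (n x + v) + t m x is divisible by m, so that m' = m / g divides
    x + u w. *)
Lemma linear_congruence (G : zmodType) (v : G) (n : int) (m : nat) :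
  torsion_free G -> ~~ (m %| n)%Z ->
  exists w m', (1 < m')%N /\ forall x, multiple m (x *~ n + v) -> multiple m' (x + w).
Proof.
move=> tf.
wlog m_gt0 : m / (0 < m)%N => [IH ndvd|ndvd].
  (* For m = 0 the congruence is an equation, which entails the congruence modulo
     |n| + 1; this modulus does not divide n. *)
  have [->|m_gt0] := posnP m; last exact: IH.
  have n_neq0 : n != 0 by case: eqP ndvd => // ->; rewrite dvdz0.
  have [||w [m' [m'_gt1 Hw]]] := IH `|n|.+1 => //.
    rewrite dvdzE /=; apply/negP => /dvdn_leq; lia.
  by exists w, m'; split=> // x /(multiple_dvd (dvdn0 `|n|.+1))/Hw.
have [u [t /esym eg]] := Bezoutz n m.
have [g Dg] : exists g : nat, gcdz n m = g by exists `|gcdz n m|%N.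
have g_gt0 : (0 < g)%N.
  by have : gcdz n m != 0; [rewrite gcdz_eq0; lia | rewrite Dg; lia].
have gn : (g %| n)%Z by rewrite -Dg dvdz_gcdl.
have gm : (g %| m)%N by have := dvdz_gcdr n m; rewrite Dg dvdzE.
have [m' Dm] := dvdnP gm.
have m'_gt1 : (1 < m')%N.
  case: m' Dm => [|[|//]] Dm; first by rewrite Dm in m_gt0.
  by rewrite mul1n in Dm; rewrite Dm gn in ndvd.
(* When g does not divide v, there is no solution and any coset will do. *)
have [[w Dv]|ngv] := pselect (multiple g v); last first.
  exists 0, 2%N; split=> // x /(multiple_dvd gm) H; case: ngv.
  by apply/(multipleDl v (multiple_Mz_dvd x gn)).
exists (w *~ u), m'; split=> // x mx.
apply/(multipleM _ _ tf g_gt0); rewrite (mulnC g) -Dm.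
have -> : (x + w *~ u) *+ g = (x *~ n + v) *~ u + x *~ (t * m).
  rewrite mulrnDl pmulrn -Dg eg mulrzDr mulrzDl -[x *~ n *~ u]mulrzA Dv.
  by rewrite !pmulrn (mulrzAC _ g) (mulrC n) -!addrA; congr (_ + _); rewrite addrC.
apply: multipleD; first exact: multipleMz.
by apply: multiple_Mz_dvd; rewrite dvdz_mull.
Qed.

Lemma avoids_congruences (G : zmodType) (I : finType)
    (n : I -> int) (m : I -> nat) (v : I -> G) :
  torsion_free G -> avoids_cosets G ->
  exists x, forall i, ~~ (m i %| n i)%Z -> ~ multiple (m i) (x *~ n i + v i).
Proof.
move=> tf av.
have step i : exists p : G * nat, (1 < p.2)%N /\ (~~ (m i %| n i)%Z ->
    forall x, multiple (m i) (x *~ n i + v i) -> multiple p.2 (x + p.1)).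
  have [dvd|/(linear_congruence (v i) tf)[w [m' [m'_gt1 H]]]] := boolP (m i %| n i)%Z.
    by exists (0, 2%N).
  by exists (w, m').
have [p Hp] := choice step.
have [|x Hx] := av [seq p i | i <- enum I].
  by move=> _ /mapP[i _ ->]; case: (Hp i).
exists x => i ndvd /(proj2 (Hp i) ndvd); apply: Hx.
by apply: map_f; rewrite mem_enum.
Qed.

(** The elements d + q x are generic above a subject to their class modulo q: all
    bounded relations not forced by that class can be avoided at once, since
    bounded coefficient vectors form a finite type. *)
Lemma avoids_bounded (G : zmodType) r B (a : nat -> G) (d : G) (q : nat) :
  torsion_free G -> avoids_cosets G ->
  exists x, forall (j : int) k (m : nat), (`|j| <= B)%N -> bounded r B k -> (m <= B)%N ->
    ~~ (m %| j * q)%Z -> ~ multiple m ((d + x *+ q) *~ j + lincomb r k a).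
Proof.
move=> tf av.
(* Integers of absolute value at most B are encoded as ordinals shifted by B. *)
pose off (o : 'I_(B + B).+1) : int := o%:Z - B%:Z.
have offK (z : int) : (`|z| <= B)%N -> off (inord (absz (z + B%:Z)%R)) = z.
  by move=> zB; rewrite /off inordK; lia.
pose K (f : {ffun 'I_r -> 'I_(B + B).+1}) : G := \sum_(i < r) a i *~ off (f i).
have [x Hx] := @avoids_congruences G
  ('I_(B + B).+1 * {ffun 'I_r -> 'I_(B + B).+1} * 'I_B.+1)%type
  (fun i => off i.1.1 * q) (fun i => i.2) (fun i => d *~ off i.1.1 + K i.1.2) tf av.
exists x => j k m jB kB mB.
have := Hx (inord (absz (j + B%:Z)%R), [ffun i : 'I_r => inord (absz (k i + B%:Z)%R)], inord m).
rewrite /= offK // inordK // => H /H{}H; apply: contra_not H.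
rewrite (_ : K _ = lincomb r k a); last first.
  by apply: eq_bigr => i _; rewrite ffunE offK //; apply: kB.
by rewrite addrA mulrzDl pmulrn -mulrzA (mulrC j) (addrC (d *~ j)).
Qed.

(** Multiplying n | j c + l.a by p and replacing p c by k.a eliminates c. *)
Lemma multiple_algebraic (G : zmodType) r (a : nat -> G) (c : G) p k j l n :
  torsion_free G -> (0 < p)%N -> c *+ p = lincomb r k a ->
  multiple n (c *~ j + lincomb r l a) <->
  multiple (p * n) (lincomb r (fun i => k i * j + l i * p%:Z) a).
Proof.
move=> tf p_gt0 Dc; rewrite -(multipleM _ _ tf p_gt0) mulrnDl.
by rewrite lincombMn !pmulrn mulrzAC -pmulrn Dc lincombMz lincombD.
Qed.

(** Subtracting s times the relation L | e c + ke.a eliminates c. *)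
Lemma multiple_congruent (G : zmodType) r (a : nat -> G) (c : G) L (e : nat) ke s l :
  multiple L (c *+ e + lincomb r ke a) ->
  multiple L (c *~ (s * e%:Z) + lincomb r l a) <->
  multiple L (lincomb r (fun i => l i - ke i * s) a).
Proof.
move=> mL; rewrite -(multipleDl (lincomb r (fun i => l i - ke i * s) a) (multipleMz s mL)).
rewrite -lincombD -lincombN -lincombMz mulrzDl pmulrn -mulrzA (mulrC s).
by rewrite [lincomb r l a + _]addrC -addrA (addrA (_ *~ s)) subrr add0r.
Qed.

(** All divisors n of L can be brought to the common modulus L. *)
Lemma multiple_scale (G : zmodType) r (a : nat -> G) (c : G) j l n L :
  torsion_free G -> (0 < L)%N -> (n %| L)%N ->
  multiple n (c *~ j + lincomb r l a) <->
  multiple L (c *~ (j * (L %/ n)%N%:Z) + lincomb r (fun i => l i * (L %/ n)%N%:Z) a).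
Proof.
move=> tf L_gt0 nL.
have q_gt0 : (0 < L %/ n)%N by rewrite divn_gt0 ?(dvdn_leq L_gt0 nL) // (dvdn_gt0 L_gt0 nL).
have -> : c *~ (j * (L %/ n)%N%:Z) + lincomb r (fun i => l i * (L %/ n)%N%:Z) a
    = (c *~ j + lincomb r l a) *+ (L %/ n).
  by rewrite mulrnDl lincombMn mulrzA.
rewrite -(multipleM (c *~ j + lincomb r l a) n tf q_gt0).
by rewrite divnK.
Qed.

(** The case of c linearly dependent on a: d is the only candidate. *)
Lemma similar_extension_dependent r N N' (G H : zmodType) (a : nat -> G) (b : nat -> H)
    (c : G) (p : nat) (k : nat -> int) :
  torsion_free G -> torsion_free H -> (0 < p <= N)%N -> bounded r N k ->
  c *+ p = lincomb r k a -> (N + 2 * N * N <= N')%N -> similar r N' a b ->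
  exists d, similar r.+1 N (prepend c a) (prepend d b).
Proof.
move=> tfG tfH /andP[p_gt0 pN] bk Dc leN' sim.
have [d Dd] : multiple p (lincomb r k b).
  apply/(sim k); [by move=> i /bk; lia | lia |].
  by rewrite -Dc; apply: multipleMn.
exists d => l bl n nN; rewrite !lincomb_cons.
rewrite (multiple_algebraic _ _ _ tfG p_gt0 Dc).
rewrite (multiple_algebraic _ _ _ tfH p_gt0 (esym Dd)).
apply: sim; last by nia.
move=> i lt_ir; have ki := bk i lt_ir.
by have li := bl i.+1 lt_ir; have l0 := bl 0%N isT; nia.
Qed.

(** The case of c linearly independent from a, as far as coefficients up to N can
    tell. Only the divisibilities satisfied by (c, a) have to be transferred; d is
    otherwise generic. *)
Lemma similar_extension_independent r N (G H : zmodType) (a : nat -> G) (b : nat -> H) (c : G) :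
  let L := N`! in
  torsion_free G -> torsion_free H -> avoids_cosets H ->
  (forall (j : int) k, (`|j| <= N)%N -> bounded r N k ->
    c *~ j + lincomb r k a = 0 -> j = 0) ->
  similar r (N + L + N * L + N * L * L) a b ->
  exists d, similar r.+1 N (prepend c a) (prepend d b).
Proof.
move=> L tfG tfH avH indep sim.
have L_gt0 : (0 < L)%N by apply: fact_gt0.
(* I is an ideal of the integers and e its positive generator. *)
pose I e := exists ke, multiple L (c *~ e + lincomb r ke a).
have IL : I L.
  exists (fun=> 0); apply: multipleD; first exact: multipleMn.
  by exists 0; rewrite mul0rn /lincomb big1 // => i _; rewrite mulr0z.
have exI : exists e : nat, (0 < e)%N && `[< I e >].
  by exists L; rewrite L_gt0; apply/asboolP.
have [e /andP[e_gt0 /asboolP[ke0 mke0]] e_min] := ex_minnP exI.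
(* Reducing the coefficients modulo L makes them small enough for [sim]. *)
pose ke i : int := (ke0 i %% L)%Z.
have mke : multiple L (c *+ e + lincomb r ke a).
  have -> : lincomb r ke a = lincomb r ke0 a + lincomb r (fun i => - ((ke0 i %/ L)%Z * L)) a.
    by rewrite lincombD; apply: eq_bigr => i _; congr (_ *~ _); rewrite [X in X + _](divz_eq _ L) addrAC subrr add0r.
  rewrite addrA; apply: multipleD => //; rewrite -lincombN -mulrN1z.
  by apply: multipleMz; rewrite -lincombMn; apply: multipleMn.
have bke : bounded r L ke.
  move=> i _; rewrite /ke; have := @modz_ge0 (ke0 i) L; have := @ltz_mod (ke0 i) L.
  lia.
have e_dvd k0 : I k0 -> (e %| k0)%Z.
  move=> [k mk]; apply/dvdz_mod0P.
  have s_ge0 : 0 <= (k0 %% e)%Z by rewrite modz_ge0 //; lia.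
  have s_lt : (k0 %% e)%Z < e by rewrite ltz_pmod //; lia.
  have Is : I (k0 %% e)%Z.
    exists (fun i => k i - ke i * (k0 %/ e)%Z).
    apply/(multipleDl _ (multipleMz (k0 %/ e)%Z mke)).
    have -> : (c *+ e + lincomb r ke a) *~ (k0 %/ e)%Z +
      (c *~ (k0 %% e)%Z + lincomb r (fun i => k i - ke i * (k0 %/ e)%Z) a) =
      c *~ k0 + lincomb r k a.
      rewrite mulrzDl lincombMz pmulrn -mulrzA addrACA -mulrzDr lincombD.
      congr (_ *~ _ + _); first by rewrite mulrC -divz_eq.
      by apply: eq_bigr => i _; congr (_ *~ _); rewrite addrC subrK.
    exact: mk.
  case: (k0 %% e)%Z Is s_ge0 s_lt => // s Is _ s_lt.
  case: (posnP s) => [-> //|s_gt0].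
  have : (e <= s)%N by apply: e_min; rewrite s_gt0; apply/asboolP.
  by lia.
have eL : (e %| L)%N by have := e_dvd _ IL.
pose q := (L %/ e)%N.
have Lq : L = (e * q)%N by rewrite mulnC divnK.
(* Any d = x q - w solves L | e d + ke.b, since e w = ke.b and e q = L. *)
have [w Dw] : multiple e (lincomb r ke b).
  apply/(sim ke).
  - by move=> i /bke; lia.
  - by have := dvdn_leq L_gt0 eL; lia.
  apply/(multipleDl _ (multipleMn c e)).
  by apply: multiple_dvd mke; exact: eL.
pose B := (N + L + N * L)%N.
have [x Hx] := avoids_bounded r B b (- w) q tfH avH.
pose d := - w + x *+ q.
have mkd : multiple L (d *+ e + lincomb r ke b).
  exists x; rewrite /d Dw mulrnDl mulNrn addrAC addNr add0r -mulrnA.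
  by rewrite mulnC -Lq.
exists d => l bl n nN; rewrite !lincomb_cons.
have l0N := bl 0%N isT.
have bl' : bounded r N (fun i => l i.+1) by move=> i lt_ir; apply: bl.
(* Equations. If the coefficient of d is nonzero, they fail on both sides. *)
have [n0|n_gt0] := posnP n.
  rewrite n0; have [l0|l0] := eqVneq (l 0%N) 0.
    rewrite l0 !mulr0z !add0r; apply: sim => // i /bl'; lia.
  split=> [/multiple0/(indep _ _ l0N bl') E0|]; first by rewrite E0 eqxx in l0.
  move=> m0; exfalso; apply: (Hx (l 0%N) (fun i => l i.+1) 0%N) m0 => //.
  - by rewrite /B; lia.
  - by move=> i /bl'; rewrite /B; lia.
  - rewrite dvd0z mulf_eq0 negb_or l0 /=.
    by apply/eqP => -[q0]; rewrite q0 muln0 in Lq; rewrite Lq in L_gt0.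
(* Divisibilities, scaled by t = L / n to the modulus L. *)
have nL : (n %| L)%N by apply: dvdn_fact; rewrite n_gt0.
rewrite (multiple_scale _ _ _ _ _ tfG L_gt0 nL) (multiple_scale _ _ _ _ _ tfH L_gt0 nL).
have tL : (L %/ n <= L)%N by apply: leq_div.
move: (L %/ n)%N tL => t tL.
have bt (z : int) : (`|z| <= N)%N -> (absz (z * t%:Z)%R <= N * L)%N.
  by rewrite abszM => zN; apply: leq_mul.
(* If e does not divide the coefficient of c, the relation fails on both sides;
   otherwise it reduces to a relation on a, respectively b. *)
have [/dvdzP[s Ds]|ndvd] := boolP (e %| l 0%N * t%:Z)%Z; last first.
  split=> [mG|mH]; first by case/negP: ndvd; apply: e_dvd; exists (fun i => l i.+1 * t%:Z).
  exfalso; apply: (Hx (l 0%N * t%:Z) (fun i => l i.+1 * t%:Z) L) mH.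
  - by have := bt _ l0N; rewrite /B; lia.
  - by move=> i /bl'/bt; rewrite /B; lia.
  - by rewrite /B; lia.
  rewrite Lq PoszM dvdz_mul2r //.
  by have := L_gt0; rewrite Lq muln_gt0 => /andP[_]; lia.
rewrite Ds (multiple_congruent _ _ mke) (multiple_congruent _ _ mkd).
apply: sim; last by lia.
move=> i lt_ir; have lt := bt _ (bl' i lt_ir); have ki := bke i lt_ir.
have sN : (`|s| <= N * L)%N by have := bt _ l0N; rewrite Ds abszM; nia.
have : (absz (ke i * s)%R <= L * (N * L))%N by rewrite abszM; apply: leq_mul.
by move: lt; move: (l i.+1 * t%:Z) (ke i * s) => u v; lia.
Qed.

Lemma similar_extension r N : exists N', forall (G H : zmodType) (a : nat -> G) (b : nat -> H),
  torsion_free G -> torsion_free H -> avoids_cosets H -> similar r N' a b ->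
  forall c, exists d, similar r.+1 N (prepend c a) (prepend d b).
Proof.
pose L := N`!; exists ((N + 2 * N * N) + (N + L + N * L + N * L * L))%N.
move=> G H a b tfG tfH avH sim c.
have [[p [k [pN [bk Dc]]]]|indep] := pselect (exists (p : nat) k,
    (0 < p <= N)%N /\ (bounded r N k /\ c *+ p = lincomb r k a)).
  by apply: (similar_extension_dependent tfG tfH pN bk Dc (leqnn _)); apply: similarW sim; apply: leq_addr.
apply: similar_extension_independent => //; last by apply: similarW sim; apply: leq_addl.
move=> j k jN bk E; apply: contrapT => j0; case: indep.
case: j jN E j0 => p pN E p0.
  exists p, (fun i => - k i); split; first by lia.
  split=> [i /bk|]; first by lia.
  by rewrite -lincombN; apply/eqP; rewrite -addr_eq0; apply/eqP.
exists p.+1, k; split=> //; split=> //.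
by move: E; rewrite NegzE mulrNz addrC => /eqP; rewrite subr_eq0 => /eqP ->.
Qed.

End Groups.

(** * Models as groups *)

Definition env_one (M : structure) (i : nat) : M := s_one M.

Record abelian_group (M : structure) : Prop := AbelianGroup {
  s_mulA : associative (@s_mul M);
  s_mulC : commutative (@s_mul M);
  s_mul1 : left_id (s_one M) (@s_mul M);
  s_mulV : left_inverse (s_one M) (@s_inv M) (@s_mul M)
}.

(** The carrier of a group, under a name that records the proof that it is one, so
    that an additive group structure can be attached to it. *)
Definition group_of (M : structure) (_ : abelian_group M) : Type := carrier M.

HB.instance Definition _ (M : structure) (hM : abelian_group M) :=
  gen_eqMixin (group_of hM).
HB.instance Definition _ (M : structure) (hM : abelian_group M) :=
  gen_choiceMixin (group_of hM).
HB.instance Definition _ (M : structure) (hM : abelian_group M) :=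
  GRing.isZmodule.Build (group_of hM)
    (s_mulA hM) (s_mulC hM) (s_mul1 hM) (s_mulV hM).

Lemma models_abelian_group (M : structure) : models M mul_theory -> abelian_group M.
Proof.
move=> hM; pose rho := @env_one M.
have mulC : commutative (@s_mul M) by move=> x y; apply: (hM _ ax_M4 rho x y).
split=> //.
- by move=> x y z; apply: (hM _ ax_M1 rho x y z).
- by move=> x; rewrite mulC; apply: (hM _ ax_M2 rho x).
- by move=> x; rewrite mulC; apply: (hM _ ax_M3 rho x).
Qed.

Lemma eval_pow (M : structure) (rho : nat -> M) t n :
  eval rho (pow t n) = iterop n (@s_mul M) (eval rho t) (s_one M).
Proof. by case: n => //; elim=> //= n ->. Qed.

Lemma sat_big_and (M : structure) (rho : nat -> M) s :
  sat rho (big_and s) <-> forall phi, phi \in s -> sat rho phi.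
Proof.
elim: s => [|phi [|psi s] IH]; first by split=> // _.
  by split=> [H chi|]; [rewrite inE => /eqP-> | apply; rewrite mem_head].
split=> [[H /IH Hs] chi|H].
  by rewrite inE => /orP[/eqP->//|/Hs].
split; first by apply: H; rewrite mem_head.
by apply/IH => chi chi_s; apply: H; rewrite inE chi_s orbT.
Qed.

Definition env_cat (M : structure) (w : seq M) (rho : nat -> M) : nat -> M :=
  foldr (@env_cons M) rho w.

Lemma env_cat_nth (M : structure) (x0 : M) w (rho : nat -> M) i :
  i < size w -> env_cat w rho i = nth x0 w i.
Proof. by elim: w i => // x w IH [|i] //= /IH. Qed.

Lemma sat_iter_All (M : structure) (rho : nat -> M) n phi :
  sat rho (iter n All phi) <-> forall w, size w = n -> sat (env_cat w rho) phi.
Proof.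
elim: n phi => [|n IH] phi; first by split=> [H [] // | /(_ [::] erefl)].
rewrite iterSr IH; split=> [H [//|x w] [sw]|H w sw x]; first exact: (H w sw x).
by apply: (H (x :: w)); rewrite /= sw.
Qed.

(** The v_k are bound from the outside in, so the last of them has the smallest
    de Bruijn index: [env_cat] has to be applied to v in reverse. *)
Lemma sat_M16 (M : structure) (rho : nat -> M) n ms :
  sat rho (M16 n ms) <->
  forall v : seq M, size v = size ms -> exists x, forall z k, k < size ms ->
    s_mul (iterop n (@s_mul M) x (s_one M)) (nth (s_one M) v k)
    <> iterop (nth 0 ms k) (@s_mul M) z (s_one M).
Proof.
rewrite /M16 sat_iter_All.
have body v x z k : size v = size ms -> k < size ms ->
    sat (env_cons z (env_cons x (env_cat (rev v) rho)))
      (Neg (Eq (Mul (pow (Var 1) n) (Var (size ms - k).+1)) (pow (Var 0) (nth 0 ms k))))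
    <-> s_mul (iterop n (@s_mul M) x (s_one M)) (nth (s_one M) v k)
        <> iterop (nth 0 ms k) (@s_mul M) z (s_one M).
  move=> sv lt_k; rewrite /= !eval_pow /=.
  rewrite -(subnSK lt_k) /= (env_cat_nth (s_one M)) ?size_rev ?sv; last by lia.
  rewrite nth_rev ?sv; last by lia.
  by rewrite (_ : size ms - (size ms - k.+1).+1 = k) //; lia.
split=> [H v sv|H w sw].
  have [x Hx] := H (rev v) (eqP (introT eqP (etrans (size_rev v) sv))).
  exists x => z k lt_k; apply/body => //.
  by move/sat_big_and: (Hx z); apply; apply: (map_f (fun k => _)); rewrite mem_iota.
have [x Hx] := H (rev w) (etrans (size_rev w) sw).
exists x => z; apply/sat_big_and => phi /mapP[k]; rewrite mem_iota => /= lt_k ->.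
by rewrite -[w]revK; apply/body; rewrite ?size_rev //; apply: Hx.
Qed.

Section ModelGroup.
Local Open Scope ring_scope.
Variables (M : structure) (hM : models M mul_theory).

Definition model_group : zmodType := group_of (models_abelian_group hM).

Lemma model_torsion_free : torsion_free model_group.
Proof.
move=> x n n_gt0 xn0.
have := hM (ax_M7 n_gt0) (@env_one M) x => /=.
by rewrite eval_pow; apply.
Qed.

Lemma model_avoids_cosets : avoids_cosets model_group.
Proof.
move=> s s_gt1; have [-> | s_neq0] := eqVneq s [::]; first by exists 0.
have ms_ok m : m \in map snd s -> (0 < m)%N /\ ~~ (m %| 1)%N.
  by case/mapP=> p /s_gt1 p_gt1 ->; rewrite dvdn1 neq_ltn p_gt1 orbT ltnW.
have ax : mul_theory (M16 1 (map snd s)).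
  by apply: ax_M16 ms_ok => //; rewrite size_map lt0n size_eq0.
have /sat_M16 := hM ax (@env_one M).
move=> /(_ (map fst s)) []; first by rewrite !size_map.
move=> x Hx; exists x => p ps [z Dz].
have lt_p : (index p s < size (map snd s))%N by rewrite size_map index_mem.
apply: (Hx z _ lt_p); rewrite size_map in lt_p.
by rewrite !(nth_map p) // nth_index.
Qed.

Fixpoint coef (t : term) (i : nat) : int :=
  match t with
  | Var j => (i == j)%:R
  | One => 0
  | Mul s u => coef s i + coef u i
  | Inv s => - coef s i
  end.

Lemma eval_lincomb r (rho : nat -> model_group) t : term_closed r t ->
  @eval M rho t = lincomb r (coef t) rho.
Proof.
elim: t => [j|_|s IHs u IHu /andP[/IHs es /IHu eu]|s IHs /IHs es] /=.
- move=> lt_jr; rewrite /lincomb (bigD1 (Ordinal lt_jr)) //= eqxx mulr1z.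
  rewrite big1 ?addr0 // => i neq_ij.
  case: eqP => [eq_ij|_]; last by rewrite mulr0z.
  by case/eqP: neq_ij; apply: val_inj.
- by rewrite /lincomb big1 // => i _; rewrite mulr0z.
- by rewrite es eu -lincombD.
- by rewrite es -lincombN.
Qed.

End ModelGroup.

(** * Elementary equivalence *)

Definition determined r N phi : Prop :=
  forall (M M' : structure) (hM : models M mul_theory) (hM' : models M' mul_theory)
    (rho : nat -> model_group hM) (rho' : nat -> model_group hM'),
  similar r N rho rho' -> @sat M rho phi <-> @sat M' rho' phi.

Lemma determinedW r N N' phi : N <= N' -> determined r N phi -> determined r N' phi.
Proof. by move=> leN det M M' hM hM' rho rho' /(similarW leN)/det. Qed.

(** The value of N for a quantified formula is the N' that [similar_extension]
    assigns to that of its body. *)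
Lemma sat_determined phi r : closed r phi -> exists N, determined r N phi.
Proof.
have det2 (a b : form) : (forall r, closed r a -> exists N, determined r N a) ->
    (forall r, closed r b -> exists N, determined r N b) ->
    forall r, closed r a && closed r b ->
    exists N, determined r N a /\ determined r N b.
  move=> Ha Hb {}r /andP[/Ha[N1 H1] /Hb[N2 H2]]; exists (maxn N1 N2); split.
    exact: determinedW (leq_maxl _ _) H1.
  exact: determinedW (leq_maxr _ _) H2.
elim: phi r => [r _|s t r /= /andP[cs ct]|a IHa b IHb r /= cab|a IHa b IHb r /= cab
   |a IHa b IHb r /= cab|a IHa r /= ca|a IHa r /= ca].
- by exists 0.
- pose k i : int := (coef s i - coef t i)%R.
  exists (\max_(i < r) `|k i|)%N => M M' hM hM' rho rho' sim.
  rewrite /= !(eval_lincomb _ cs) !(eval_lincomb _ ct).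
  have bk : bounded r (\max_(i < r) `|k i|)%N k.
    by move=> i lt_ir; apply: (leq_bigmax (Ordinal lt_ir)).
  have eq0 (G : zmodType) (x : nat -> G) :
      lincomb r (coef s) x = lincomb r (coef t) x <-> multiple 0 (lincomb r k x).
    rewrite multiple0 -lincombD -lincombN.
    by split=> [->|/eqP]; [rewrite subrr|rewrite subr_eq0 => /eqP].
  by apply: iff_trans (eq0 _ rho) (iff_trans _ (iff_sym (eq0 _ rho'))); apply: sim.
- have [N [Ha Hb]] := det2 _ _ IHa IHb r cab; exists N => M M' hM hM' rho rho' sim.
  by rewrite /= (Ha _ _ _ _ _ _ sim) (Hb _ _ _ _ _ _ sim).
- have [N [Ha Hb]] := det2 _ _ IHa IHb r cab; exists N => M M' hM hM' rho rho' sim.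
  by rewrite /= (Ha _ _ _ _ _ _ sim) (Hb _ _ _ _ _ _ sim).
- have [N [Ha Hb]] := det2 _ _ IHa IHb r cab; exists N => M M' hM hM' rho rho' sim.
  by rewrite /= (Ha _ _ _ _ _ _ sim) (Hb _ _ _ _ _ _ sim).
- have [N HN] := IHa _ ca; have [N' ext] := similar_extension r N.
  exists N' => M M' hM hM' rho rho' sim.
  have sim' : similar r N' rho' rho by move=> k bk n nN; rewrite (sim k bk n nN).
  split=> sat_a d.
    have [c simc] := ext _ _ _ _ (@model_torsion_free _ hM') (@model_torsion_free _ hM)
      (@model_avoids_cosets _ hM) sim' d.
    by apply/(HN _ _ _ _ _ _ simc); apply: sat_a.
  have [c simc] := ext _ _ _ _ (@model_torsion_free _ hM) (@model_torsion_free _ hM')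
    (@model_avoids_cosets _ hM') sim d.
  by apply/(HN _ _ _ _ _ _ simc); apply: sat_a.
- have [N HN] := IHa _ ca; have [N' ext] := similar_extension r N.
  exists N' => M M' hM hM' rho rho' sim.
  have sim' : similar r N' rho' rho by move=> k bk n nN; rewrite (sim k bk n nN).
  split=> -[d sat_a].
    have [c simc] := ext _ _ _ _ (@model_torsion_free _ hM) (@model_torsion_free _ hM')
      (@model_avoids_cosets _ hM') sim d.
    by exists c; apply/(HN _ _ _ _ _ _ simc).
  have [c simc] := ext _ _ _ _ (@model_torsion_free _ hM') (@model_torsion_free _ hM)
    (@model_avoids_cosets _ hM) sim' d.
  by exists c; apply/(HN _ _ _ _ _ _ simc).
Qed.

(** With r = 0 all linear combinations are 0, so similarity holds trivially. *)
Lemma elementarily_equivalent (M M' : structure) phi :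
  models M mul_theory -> models M' mul_theory -> sentence phi ->
  true_in M phi -> true_in M' phi.
Proof.
move=> hM hM' /sat_determined[N HN] Mphi rho'.
apply/(HN _ _ hM hM' (@env_one M) rho'); last exact: Mphi.
by move=> k _ n _; rewrite /lincomb !big_ord0; split=> _; exists 0%R; rewrite mul0rn.
Qed.

(** * The positive rationals *)

Lemma val_Qpos_pow (x : Qpos) n :
  val (iterop n Qpos_mul x Qpos_one) = (val x ^+ n)%R.
Proof. by case: n => //; elim=> //= n ->. Qed.

Lemma Qpos_fraction (x : Qpos) : exists a b : nat,
  [/\ 0 < a, 0 < b & (val x * b%:R = a%:R)%R].
Proof.
case: x => x x_gt0 /=; exists `|numq x|, `|denq x|; split.
- by rewrite absz_gt0 numq_eq0 gt_eqF.
- by rewrite absz_gt0 denq_eq0.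
- rewrite !pmulrn !gez0_abs ?denq_ge0 ?numq_ge0 ?ltW //.
  by rewrite -[X in (X * _)%R]divq_num_den divfK // intr_eq0 denq_eq0.
Qed.

Lemma prime_not_dividing (s : seq nat) : exists2 p, prime p &
  forall a, a \in s -> 0 < a -> logn p a = 0.
Proof.
have [p lt_p pr_p] := prime_above (\sum_(a <- s) a).
exists p => // a a_s a_gt0; apply/eqP; rewrite lognE pr_p a_gt0 /=.
case: ifP => // /(dvdn_leq a_gt0) le_pa.
by have := leq_trans lt_p le_pa; rewrite (big_rem a) //= ltnNge leq_addr.
Qed.

(** The witness is a prime p that divides no numerator or denominator of the v_k.
    Clearing denominators in p^n v_k = z^m and taking p-adic valuations gives
    m | n. *)
Lemma Qpos_M16 n ms : (forall m, m \in ms -> 0 < m /\ ~~ (m %| n)) ->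
  true_in Qpos_structure (M16 n ms).
Proof.
move=> msP rho; apply/sat_M16 => v sv.
have frac (x : Qpos) : exists ab : nat * nat,
    [/\ 0 < ab.1, 0 < ab.2 & (val x * ab.2%:R = ab.1%:R)%R].
  by have [a [b ab]] := Qpos_fraction x; exists (a, b).
have [f Hf] := choice frac.
have [p pr_p Hp] := prime_not_dividing
  ([seq (f x).1 | x <- v] ++ [seq (f x).2 | x <- v]).
have p_gt0 : (0 < p%:R :> rat)%R by rewrite ltr0n prime_gt0.
exists (exist _ (p%:R : rat)%R p_gt0) => z k lt_k /(congr1 val) /=.
rewrite !val_Qpos_pow /=.
set m := nth 0 ms k; set x := nth _ v k => E.
have [m_gt0 /negP[]] := msP m (mem_nth _ lt_k).
have xv : x \in v by rewrite mem_nth // sv.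
have [a_gt0 b_gt0 Dx] := Hf x; have [c_gt0 d_gt0 Dz] := Hf z.
have pa : logn p (f x).1 = 0.
  by apply: Hp a_gt0; rewrite mem_cat (map_f (fun y => (f y).1) xv).
have pb : logn p (f x).2 = 0.
  by apply: Hp b_gt0; rewrite mem_cat (map_f (fun y => (f y).2) xv) orbT.
move: (f x) (f z) pa pb a_gt0 b_gt0 Dx c_gt0 d_gt0 Dz.
case=> a b [c d] /= pa pb a_gt0 b_gt0 Dx c_gt0 d_gt0 Dz.
(* The equation p^n (a / b) = (c / d)^m without denominators. *)
have Enat : (p ^ n * a * d ^ m = c ^ m * b)%N.
  apply/eqP; rewrite -(eqr_nat rat) !natrM !natrX -Dx -Dz exprMn -E.
  by apply/eqP; ring.
have := congr1 (logn p) Enat.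
rewrite !lognM ?expn_gt0 ?muln_gt0 ?expn_gt0 ?d_gt0 ?c_gt0 ?a_gt0 ?(prime_gt0 pr_p) //.
rewrite !lognX logn_prime // eqxx pa pb muln1 !addn0 => En.
by rewrite -(dvdn_addl _ (dvdn_mulr (logn p d) (dvdnn m))) En dvdn_mulr.
Qed.

Lemma Qpos_models : models Qpos_structure mul_theory.
Proof.
move=> _ [||||n n_gt0|n ms _ _ /Qpos_M16//] rho.
- by move=> x y z; apply: val_inj; rewrite /= mulrA.
- by move=> x; apply: val_inj; rewrite /= mulr1.
- by move=> x; apply: val_inj; rewrite /= divff // gt_eqF // (valP x).
- by move=> x y; apply: val_inj; rewrite /= mulrC.
- move=> x; rewrite /= eval_pow => /(congr1 val); rewrite /= val_Qpos_pow => xn1.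
  apply: val_inj => /=; apply/eqP; rewrite -(@pexpr_eq1 _ _ n) //.
    exact/eqP.
  exact/ltW/(valP x).
Qed.

Lemma closed_iter_All r n phi : closed r (iter n All phi) = closed (r + n) phi.
Proof. by elim: n r => [|n IH] r /=; rewrite ?addn0 // IH addnS. Qed.

Lemma closed_big_and r s : closed r (big_and s) = all (closed r) s.
Proof. by elim: s => [|phi [|psi s] IH] //=; rewrite ?andbT // IH. Qed.

Lemma closed_pow r t n : term_closed r t -> term_closed r (pow t n).
Proof. by move=> ct; case: n => //; elim=> //= n ->; rewrite ct. Qed.

Lemma mul_theory_sentence phi : mul_theory phi -> sentence phi.
Proof.
case=> // [n _|n ms _ _ _]; rewrite /sentence.
  by rewrite /= closed_pow.
rewrite /M16 closed_iter_All /= closed_big_and; apply/allP => psi /mapP[k].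
rewrite mem_iota => /= lt_k -> /=; rewrite !closed_pow // !andbT /=.
lia.
Qed.

Theorem theorem4p11 : completely_axiomatizes mul_theory Qpos_structure.
Proof.
move=> phi sphi; split=> [true_phi|]; last exact/provable_sound/Qpos_models.
apply: completeness => // [psi|M hM]; first exact: mul_theory_sentence.
exact: elementarily_equivalent Qpos_models hM sphi true_phi.
Qed.
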